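(* Let $\mathcal{X}\subset\mathbb{R}^d$ be a nonempty compact convex set and let $f$ be convex on $\mathcal{X}$ and differentiable on an open set containing $\mathcal{X}$. Consider a run of either the Frank-Wolfe (FW) algorithm or the heavy-ball Frank-Wolfe (HB-FW) algorithm, with the associated primal-dual gaps $G_t$ (see context). Then, for every $t>1$ and every value $\gamma_t=\gamma\in[0,1]$ of the step size at iteration $t$ (with arbitrary step sizes in previous iterations), $$G_t\le(1-\gamma)G_{t-1}-\gamma\langle\nabla f(x_t),v_t-x_t\rangle-f(x_t)+f((1-\gamma)x_t+\gamma v_t),\qquad(\ast)$$ and, for fixed $x_t$, $v_t$ and $G_{t-1}$, the right-hand side of $(\ast)$ is a convex function of $\gamma\in[0,1]$. If moreover $f$ is $L$-smooth on $\mathcal{X}$ with respect to a norm $\|\cdot\|$ and $D=\max_{x,y\in\mathcal{X}}\|x-y\|$, and if for all $t\ge1$ the step sizes are chosen either (a) by the primal-dual short step $\gamma_t=\min\left\{1,\frac{G_{t-1}}{L\|v_t-x_t\|^2}\right\}$ (read as $\gamma_t=1$ if $v_t=x_t$), or (b) by line search, i.e. $\gamma_t$ minimizes the right-hand side of $(\ast)$ over $\gamma\in[0,1]$ (with $x_t,v_t,G_{t-1}$ fixed), then, for either algorithm and all $t\ge 0$, $$G_t\le\frac{4LD^2}{t+2}.$$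
   Context: $f$ is $L$-smooth on $\mathcal{X}$ w.r.t. $\|\cdot\|$ if $f(y)-f(x)-\langle\nabla f(x),y-x\rangle\le\frac L2\|x-y\|^2$ for all $x,y\in\mathcal{X}$. Weights: step sizes are $\gamma_0=1$ and $\gamma_t\in[0,1]$ for $t\ge1$. Put $\lambda_{t,i}=\gamma_i\prod_{j=i+1}^t(1-\gamma_j)$ for $0\le i\le t$, so that $\lambda_{t,i}\ge0$ and $\sum_{i=0}^t\lambda_{t,i}=1$. (In terms of positive weights $a_i$ and $A_t=\sum_{i=0}^t a_i$ with $\gamma_t=a_t/A_t$, one has $\lambda_{t,i}=a_i/A_t$.) Both algorithms start from $x_0\in\mathcal{X}$ and iterate $x_{t+1}=(1-\gamma_t)x_t+\gamma_tv_t$ for $t\ge0$, where: FW: $v_t\in\arg\min_{v\in\mathcal{X}}\langle\nabla f(x_t),v\rangle$, and the lower bound on $\min_{\mathcal{X}}f$ is $L_t=\sum_{i=0}^t\lambda_{t,i}\left(f(x_i)+\langle\nabla f(x_i),v_i-x_i\rangle\right)$. HB-FW: $v_t\in\arg\min_{v\in\mathcal{X}}\sum_{i=0}^t\lambda_{t,i}\langle\nabla f(x_i),v\rangle$, and $L_t=\sum_{i=0}^t\lambda_{t,i}\left(f(x_i)+\langle\nabla f(x_i),v_t-x_i\rangle\right)$. (Here $v_t$ may depend on $\gamma_t$; in (a) and (b) the stated relation is required to hold between $\gamma_t$ and the point $v_t$ actually used at iteration $t$.) In both cases the primal-dual gap is $G_t=f(x_{t+1})-L_t$. *)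

(* Defs.v *)
From mathcomp Require Import all_boot all_order all_algebra.
From mathcomp Require Import boolp classical_sets set_interval reals topology.
From mathcomp Require Import normedtype derive convex.

Set Implicit Arguments.
Unset Strict Implicit.
Unset Printing Implicit Defensive.

Import Order.TTheory GRing.Theory Num.Theory.
Import numFieldNormedType.Exports.

Local Open Scope classical_set_scope.
Local Open Scope ring_scope.

Definition dotv (R : realType) (d : nat) (u w : 'rV[R]_d) : R :=
  \sum_(i < d) u 0 i * w 0 i.

(* The vector of partial derivatives: 'D_u f y is the derivative of f at y in
   direction u, and delta_mx 0 i is the i-th standard basis row vector. *)
Definition grad (R : realType) (d : nat) (f : 'rV[R]_d -> R) (y : 'rV[R]_d) :
    'rV[R]_d :=
  \row_(i < d) 'D_(delta_mx 0 i) f y.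

(* An arbitrary norm on R^d, unrelated to the library's sup norm `|x| that
   carries the topology. Nonnegativity follows from the three axioms. *)
Definition is_norm (R : realType) (d : nat) (N : 'rV[R]_d -> R) : Prop :=
  [/\ forall u w, N (u + w) <= N u + N w,
      forall (a : R) u, N (a *: u) = `|a| * N u
    & forall u, N u = 0 -> u = 0].

Definition smooth_on (R : realType) (d : nat) (X : set 'rV[R]_d)
    (f : 'rV[R]_d -> R) (N : 'rV[R]_d -> R) (L : R) : Prop :=
  forall x y, X x -> X y ->
    f y - f x - dotv (grad f x) (y - x) <= L / 2 * N (x - y) ^+ 2.

Definition is_diameter (R : realType) (d : nat) (X : set 'rV[R]_d)
    (N : 'rV[R]_d -> R) (D : R) : Prop :=
  let S := [set N (p.1 - p.2) | p in X `*` X] in S D /\ ubound S D.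

Definition is_argmin (R : realType) (T : Type) (A : set T) (phi : T -> R)
    (a : T) : Prop :=
  A a /\ forall b, A b -> phi a <= phi b.

Definition weight (R : realType) (gamma : nat -> R) (t i : nat) : R :=
  gamma i * \prod_(i.+1 <= j < t.+1) (1 - gamma j).

Variant algorithm := FW | HBFW.

Section Algorithms.
Context {R : realType} {d : nat}.
Variables (alg : algorithm) (f : 'rV[R]_d -> R).
Variables (gamma : nat -> R) (x v : nat -> 'rV[R]_d).

Definition oracle_objective (t : nat) (u : 'rV[R]_d) : R :=
  match alg with
  | FW => dotv (grad f (x t)) u
  | HBFW => \sum_(i < t.+1) weight gamma t i * dotv (grad f (x i)) u
  end.

Definition lower_bound (t : nat) : R :=
  match alg with
  | FW => \sum_(i < t.+1)
      weight gamma t i * (f (x i) + dotv (grad f (x i)) (v i - x i))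
  | HBFW => \sum_(i < t.+1)
      weight gamma t i * (f (x i) + dotv (grad f (x i)) (v t - x i))
  end.

Definition gap (t : nat) : R := f (x t.+1) - lower_bound t.

(* For HBFW, oracle_objective t involves gamma t through the weights, so v t
   may depend on gamma t. *)
Definition is_run (X : set 'rV[R]_d) : Prop :=
  [/\ gamma 0%N = 1,
      forall t : nat, (1 <= t)%N -> 0 <= gamma t <= 1,
      X (x 0%N),
      forall t : nat, x t.+1 = (1 - gamma t) *: x t + gamma t *: v t
    & forall t : nat, is_argmin X (oracle_objective t) (v t)].

End Algorithms.

Definition gap_bound (R : realType) (d : nat) (f : 'rV[R]_d -> R)
    (xt vt : 'rV[R]_d) (Gprev : R) (c : R) : R :=
  (1 - c) * Gprev - c * dotv (grad f xt) (vt - xt)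
    - f xt + f ((1 - c) *: xt + c *: vt).

(* L > 0 is intended; if L = 0 and vt <> xt then r / 0 = 0 makes the step 0. *)
Definition short_step (R : realType) (d : nat) (N : 'rV[R]_d -> R) (L : R)
    (xt vt : 'rV[R]_d) (Gprev : R) : R :=
  if vt == xt then 1
  else Num.min 1 (Gprev / (L * N (vt - xt) ^+ 2)).

(* Main.v *)
(* Since lambda_{t,i} = (1 - gamma_t) lambda_{t-1,i} for i < t, the lower bounds
   satisfy L_t >= (1 - gamma_t) L_{t-1} + gamma_t (f(x_t) + <grad f(x_t), v_t - x_t>):
   for FW this is an equality, for HB-FW it follows from the optimality of
   v_{t-1}. This is (star). Smoothness bounds its right-hand side by
   (1 - c) G_{t-1} + c^2 L |v_t - x_t|^2 / 2, so both step rules give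
   G_t <= (1 - s) G_{t-1} + s^2 L D^2 / 2 for every s in [0, 1], and s = 2/(t+2)
   yields the rate by induction. *)
Require Import Defs.
From mathcomp Require Import all_boot all_order all_algebra.
From mathcomp Require Import ring lra.
From mathcomp Require Import boolp classical_sets set_interval reals topology.
From mathcomp Require Import interval_inference normedtype derive convex.

Import Order.TTheory GRing.Theory Num.Theory.
Import numFieldNormedType.Exports.

Local Open Scope classical_set_scope.
Local Open Scope ring_scope.

(** * Dot product and directional derivatives *)

Section Dot.
Context {R : realType} {d : nat}.
Implicit Types g u w : 'rV[R]_d.

Lemma dotvB g u w : dotv g (u - w) = dotv g u - dotv g w.
Proof.
by rewrite /dotv -sumrB; apply: eq_bigr => i _; rewrite !mxE mulrBr.
Qed.

Lemma dotvZ g a u : dotv g (a *: u) = a * dotv g u.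
Proof.
by rewrite /dotv mulr_sumr; apply: eq_bigr => i _; rewrite !mxE mulrCA.
Qed.

Lemma derive_dot_grad (f : 'rV[R]_d -> R) y u :
  differentiable f y -> 'D_u f y = dotv (grad f y) u.
Proof.
move=> df; rewrite deriveE// {1}(row_sum_delta u) linear_sum.
by apply: eq_bigr => i _; rewrite linearZ mxE deriveE// mulrC.
Qed.

End Dot.

(** * Convexity along segments and the first-order inequality *)

Section Convexity.
Context {R : realType} {d : nat}.
Variables (X : set 'rV[R]_d) (f : 'rV[R]_d -> R).
Hypotheses (cX : convex_set X) (cf : convex_function X f).

Lemma convex_set_segment a b (c : R) :
  X a -> X b -> 0 <= c <= 1 -> X ((1 - c) *: a + c *: b).
Proof.
move=> Xa Xb /andP[c0 c1].
have := cX b a (Itv01 c0 c1) (mem_set Xb) (mem_set Xa).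
by move/set_mem; rewrite addrC.
Qed.

Lemma convex_function_segment a b (c : R) :
  X a -> X b -> 0 <= c <= 1 ->
  f ((1 - c) *: a + c *: b) <= (1 - c) * f a + c * f b.
Proof.
move=> Xa Xb /andP[c0 c1].
have := cf (Itv01 c0 c1) b a (mem_set Xb) (mem_set Xa).
by rewrite addrC [leRHS]addrC.
Qed.

(** By convexity, the difference quotient of [f] from [a] towards [b] is at most [f b - f a] for
    each step in (0, 1]; the limit inherits the bound. *)
Lemma convex_gradient_le a b : X a -> X b -> differentiable f a ->
  dotv (grad f a) (b - a) <= f b - f a.
Proof.
move=> Xa Xb df; rewrite -derive_dot_grad//.
have cvgD : cvg ((fun h : R => h^-1 *: ((f \o shift a) (h *: (b - a)) - f a))
    @ 0^').
  exact: (@diff_derivable _ _ _ f a (b - a)).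
(* Only small positive steps stay on the segment, so the two-sided limit is replaced by the
   right-hand one. *)
rewrite /derive cvg_at_rightE//; apply: limr_le.
  by apply/cvg_ex; case/cvg_ex: cvgD => l ?; exists l; exact: cvg_dnbhs_at_right.
near=> h.
have h0 : 0 < h by near: h; exact: nbhs_right_gt.
have h1 : h <= 1 by near: h; exact: nbhs_right_le.
rewrite /= -[_ *: _]/(h^-1 * _) mulrC ler_pdivrMr//.
have -> : h *: (b - a) + a = (1 - h) *: a + h *: b.
  by apply/rowP => i; rewrite !mxE; ring.
have := convex_function_segment _ _ _ Xa Xb (introT andP (conj (ltW h0) h1)).
lra.
Unshelve. all: by end_near. Qed.

(** As a function of the step, this is an affine function plus [f] along an affine path inside
    [X]. *)
Lemma convex_gap_bound (xt vt : 'rV[R]_d) (G : R) : X xt -> X vt ->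
  convex_function (`[0, 1]%classic : set R) (gap_bound f xt vt G).
Proof.
move=> Xx Xv p c c' /set_mem + /set_mem +; rewrite /= !in_itv/=.
suff key (q a b : R) : 0 <= q <= 1 -> 0 <= a <= 1 -> 0 <= b <= 1 ->
    gap_bound f xt vt G (q * a + (1 - q) * b) <=
    q * gap_bound f xt vt G a + (1 - q) * gap_bound f xt vt G b.
  by apply: key; rewrite ge0 le1.
move=> q01 a01 b01; rewrite /gap_bound.
set y := (1 - a) *: xt + a *: vt; set y' := (1 - b) *: xt + b *: vt.
have Xy : X y by exact: convex_set_segment.
have Xy' : X y' by exact: convex_set_segment.
have -> : (1 - (q * a + (1 - q) * b)) *: xt + (q * a + (1 - q) * b) *: vt
    = (1 - q) *: y' + q *: y.
  by apply/rowP => i; rewrite !mxE; ring.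
have := convex_function_segment _ _ q Xy' Xy q01; lra.
Qed.

End Convexity.

(** * Quadratic majorant from smoothness *)

Section Smoothness.
Context {R : realType} {d : nat}.
Variables (X : set 'rV[R]_d) (f N : 'rV[R]_d -> R) (L D : R).
Hypotheses (nN : is_norm N) (sf : smooth_on X f N L).

Lemma is_normN u : N (- u) = N u.
Proof. by case: nN => _ NZ _; rewrite -scaleN1r NZ normrN normr1 mul1r. Qed.

Lemma is_norm0 : N 0 = 0.
Proof. by case: nN => _ NZ _; rewrite -(scale0r 0) NZ normr0 mul0r. Qed.

Lemma is_norm_ge0 u : 0 <= N u.
Proof.
by case: nN => ND _ _; have := ND u (- u); rewrite subrr is_norm0 is_normN; lra.
Qed.

Hypotheses (cX : convex_set X) (cf : convex_function X f).
Hypothesis df : forall y, X y -> differentiable f y.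

(** Half of this quantity bounds the linearization error of [f], which is nonnegative by
    convexity. *)
Lemma smooth_coef_ge0 a b : X a -> X b -> 0 <= L * N (b - a) ^+ 2.
Proof.
move=> Xa Xb; have := sf _ _ Xa Xb; rewrite -is_normN opprB.
have := convex_gradient_le X f cf _ _ Xa Xb (df _ Xa); lra.
Qed.

(* [L] may be negative here, but then convexity forces [D = 0]. *)
Lemma smooth_coef_diam a b : is_diameter X N D -> X a -> X b ->
  L * N (b - a) ^+ 2 <= L * D ^+ 2.
Proof.
case=> -[[p q] [/= Xp Xq] DE] ubD Xa Xb.
have ND : N (b - a) <= D by apply: ubD; exists (b, a).
have N0 := is_norm_ge0 (b - a).
have ND2 : N (b - a) ^+ 2 <= D ^+ 2 by rewrite ler_pXn2r ?nnegrE//; lra.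
have [L0|L0] := leP 0 L; first by rewrite ler_wpM2l.
have := smooth_coef_ge0 _ _ Xq Xp; rewrite DE nmulr_rge0// => D2.
have -> : N (b - a) ^+ 2 = D ^+ 2 by have := sqr_ge0 (N (b - a)); lra.
exact: lexx.
Qed.

(** The term [- c * dotv (grad f xt) (vt - xt)] cancels the first-order part of [f] along the step;
    only the quadratic error remains. *)
Lemma gap_bound_smooth (xt vt : 'rV[R]_d) (G c : R) :
  X xt -> X vt -> 0 <= c <= 1 ->
  gap_bound f xt vt G c <=
    (1 - c) * G + L * N (vt - xt) ^+ 2 / 2 * c ^+ 2.
Proof.
move=> Xx Xv c01; have [c0 c1] := andP c01.
have := sf _ _ Xx (convex_set_segment X cX _ _ _ Xx Xv c01).
rewrite -is_normN opprB.
have -> : (1 - c) *: xt + c *: vt - xt = c *: (vt - xt).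
  by apply/rowP => i; rewrite !mxE; ring.
case: nN => _ NZ _; rewrite NZ ger0_norm// dotvZ exprMn /gap_bound; lra.
Qed.

End Smoothness.

(** * Real inequalities for the step size and the rate *)

Section Scalar.
Context {R : realType}.
Implicit Types K G s C : R.

(** The vertex of this convex quadratic is [G / K], and [c] is the vertex capped at 1. *)
Lemma short_step_minimizes K G s c : 0 < K -> s <= 1 -> c = Num.min 1 (G / K) ->
  (1 - c) * G + K / 2 * c ^+ 2 <= (1 - s) * G + K / 2 * s ^+ 2.
Proof.
move=> K0 s1 ->; set q := G / K.
have -> : G = q * K by rewrite divfK// gt_eqF.
have [q1|q1] := leP 1 q.
  rewrite -subr_ge0.
  have -> : (1 - s) * (q * K) + K / 2 * s ^+ 2
      - ((1 - 1) * (q * K) + K / 2 * 1 ^+ 2)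
    = K * (1 - s) * ((q - 1) + (1 - s) / 2) by field.
  by apply: mulr_ge0; [apply: mulr_ge0|]; lra.
rewrite -subr_ge0.
have -> : (1 - s) * (q * K) + K / 2 * s ^+ 2
    - ((1 - q) * (q * K) + K / 2 * q ^+ 2) = K / 2 * (s - q) ^+ 2 by field.
by rewrite mulr_ge0 ?sqr_ge0//; lra.
Qed.

(** Induction step of the rate: [2 / (n + 3)] is the comparison step 2/(t+2) at t = n + 1. *)
Lemma rate_recursion C G n : 0 <= C -> G <= 4 * C / (n + 2)%:R ->
  (1 - 2 / (n + 3)%:R) * G + C / 2 * (2 / (n + 3)%:R) ^+ 2 <= 4 * C / (n + 3)%:R.
Proof.
move=> C0; rewrite !natrD; set a := n%:R : R => GC.
have a0 : 0 <= a by exact: ler0n.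
have s1 : 0 <= 1 - 2 / (a + 3).
  by rewrite subr_ge0 ler_pdivrMr; lra.
apply: (@le_trans _ _ ((1 - 2 / (a + 3)) * (4 * C / (a + 2))
    + C / 2 * (2 / (a + 3)) ^+ 2)).
  by rewrite lerD2r ler_wpM2l.
rewrite -subr_ge0.
have -> : 4 * C / (a + 3) - ((1 - 2 / (a + 3)) * (4 * C / (a + 2))
    + C / 2 * (2 / (a + 3)) ^+ 2)
  = C * (2 * a + 8) / ((a + 2) * (a + 3) ^+ 2).
  by field; apply/andP; split; apply: lt0r_neq0; lra.
by apply: divr_ge0; apply: mulr_ge0; rewrite ?sqr_ge0//; lra.
Qed.

End Scalar.

(** * Weights, lower bounds and gaps along a run *)

Section Run.
Context {R : realType} {d : nat}.
Variables (X : set 'rV[R]_d) (f : 'rV[R]_d -> R) (alg : algorithm).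
Variables (gamma : nat -> R) (x v : nat -> 'rV[R]_d).
Hypotheses (cX : convex_set X) (run : is_run alg f gamma x v X).

Lemma run_step01 t : 0 <= gamma t <= 1.
Proof.
by case: run => g0 g01 _ _ _; case: t => [|t]; rewrite ?g0 ?ler01 ?lexx ?g01.
Qed.

Lemma run_oracle_mem t : X (v t).
Proof. by case: run => _ _ _ _ /(_ t)[]. Qed.

Lemma run_iterate_mem t : X (x t).
Proof.
case: run => _ _ X0 xS _; elim: t => // t IH; rewrite xS.
by apply: convex_set_segment => //; [exact: run_oracle_mem|exact: run_step01].
Qed.

Lemma weight_diag t : weight gamma t t = gamma t.
Proof. by rewrite /weight big_geq// mulr1. Qed.

Lemma weightS t i : (i <= t)%N ->
  weight gamma t.+1 i = (1 - gamma t.+1) * weight gamma t i.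
Proof.
by move=> it; rewrite /weight big_nat_recr//= mulrA mulrC.
Qed.

Lemma sum_weightS t (F : nat -> R) :
  \sum_(i < t.+2) weight gamma t.+1 i * F i =
  (1 - gamma t.+1) * (\sum_(i < t.+1) weight gamma t i * F i)
  + gamma t.+1 * F t.+1.
Proof.
rewrite big_ord_recr/= weight_diag; congr (_ + _).
by rewrite mulr_sumr; apply: eq_bigr => i _; rewrite mulrA weightS// -ltnS.
Qed.

Lemma lower_bound0 :
  lower_bound alg f gamma x v 0 =
    f (x 0%N) + dotv (grad f (x 0%N)) (v 0%N - x 0%N).
Proof.
have g0 : gamma 0%N = 1 by case: run.
by rewrite /lower_bound; case: alg; rewrite big_ord1 weight_diag g0 mul1r.
Qed.

(* An equality for FW. For HB-FW, moving the linear minorants of the first [t]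
   steps from [v t] to [v t.+1] can only increase their weighted sum, since
   [v t] minimizes it. *)
Lemma lower_boundS t :
  (1 - gamma t.+1) * lower_bound alg f gamma x v t
  + gamma t.+1 * (f (x t.+1) + dotv (grad f (x t.+1)) (v t.+1 - x t.+1))
  <= lower_bound alg f gamma x v t.+1.
Proof.
have [_ g1] := andP (run_step01 t.+1).
case: run => _ _ _ _ /(_ t)[_ /(_ _ (run_oracle_mem t.+1))].
rewrite /oracle_objective /lower_bound; case: alg => opt.
  by rewrite (sum_weightS t (fun i => f (x i) + dotv (grad f (x i)) (v i - x i))).
rewrite (sum_weightS t (fun i => f (x i) + dotv (grad f (x i)) (v t.+1 - x i))).
rewrite lerD2r ler_wpM2l ?subr_ge0//.
(* As a function of [u], the averaged minorant is the HB-FW oracle objective plus a constant, so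
   optimality of [v t] carries over to it. *)
have splitE u : \sum_(i < t.+1)
    weight gamma t i * (f (x i) + dotv (grad f (x i)) (u - x i)) =
  \sum_(i < t.+1) weight gamma t i * (f (x i) - dotv (grad f (x i)) (x i))
  + \sum_(i < t.+1) weight gamma t i * dotv (grad f (x i)) u.
  by rewrite -big_split; apply: eq_bigr => i _ /=; rewrite dotvB; ring.
by rewrite !splitE lerD2l.
Qed.

(** Substitute [f (x t.+1)] minus the gap for the previous lower bound in [lower_boundS]; the values
    [f (x t.+1)] then have total weight 1. *)
Lemma gap_le_gap_bound t : gap alg f gamma x v t.+1 <=
  gap_bound f (x t.+1) (v t.+1) (gap alg f gamma x v t) (gamma t.+1).
Proof.
rewrite /gap /gap_bound; have := lower_boundS t.
case: run => _ _ _ xS _; rewrite -(xS t.+1); lra.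
Qed.

(** * Convergence rate under either step rule *)

Section Rate.
Variables (N : 'rV[R]_d -> R) (L D : R).
Hypotheses (cf : convex_function X f).
Hypothesis df : forall y, X y -> differentiable f y.
Hypotheses (nN : is_norm N) (sf : smooth_on X f N L).
Hypothesis diamD : is_diameter X N D.

Let C := L * D ^+ 2.
Let K t := L * N (v t - x t) ^+ 2.

Let K_ge0 t : 0 <= K t.
Proof.
exact: (smooth_coef_ge0 X f N L nN sf cf df _ _ (run_iterate_mem t)
  (run_oracle_mem t)).
Qed.

Let K_le t : K t <= C.
Proof.
exact: (smooth_coef_diam X f N L D nN sf cf df _ _ diamD (run_iterate_mem t)
  (run_oracle_mem t)).
Qed.

(** Since [gamma 0] is 1, the first iterate is [v 0], and the initial gap is exactly the
    linearization error from [x 0] to [v 0]. *)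
Lemma gap0_le : gap alg f gamma x v 0 <= C / 2.
Proof.
have := sf _ _ (run_iterate_mem 0) (run_oracle_mem 0).
rewrite -(is_normN N nN) opprB.
have x1 : x 1%N = v 0%N.
  by case: run => g0 _ _ -> _; rewrite g0 subrr scale0r add0r scale1r.
have := K_le 0; rewrite /gap lower_bound0 x1 /K; lra.
Qed.

(* The short step minimizes a quadratic majorant of the gap bound, and line
   search the gap bound itself; in both cases one may compare with an
   arbitrary step size [s]. The first disjunct covers the short step when
   [v t.+1 = x t.+1], and when [L = 0], where the division by zero makes the
   step 0 instead of the minimizer. *)
Lemma gap_le_any_step t (s : R) : 0 <= s <= 1 ->
  gamma t.+1 = short_step N L (x t.+1) (v t.+1) (gap alg f gamma x v t) \/
  is_argmin `[0, 1]%classic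
    (gap_bound f (x t.+1) (v t.+1) (gap alg f gamma x v t)) (gamma t.+1) ->
  (L = 0 -> gap alg f gamma x v t <= 0) ->
  gap alg f gamma x v t.+1 <= 0 \/
  gap alg f gamma x v t.+1 <=
    (1 - s) * gap alg f gamma x v t + C / 2 * s ^+ 2.
Proof.
move=> s01 step L0; have le_gb := gap_le_gap_bound t; have [s0 s1] := andP s01.
have quad c := gap_bound_smooth X f N L nN sf cX _ _ (gap alg f gamma x v t) c
  (run_iterate_mem t.+1) (run_oracle_mem t.+1).
have KC : K t.+1 / 2 * s ^+ 2 <= C / 2 * s ^+ 2.
  by rewrite ler_wpM2r ?sqr_ge0// ler_wpM2r// invr_ge0 ler0n.
have := le_trans le_gb (quad _ (run_step01 t.+1)); rewrite -/(K t.+1).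
case: step => [|[_ /(_ s)]]; last first.
  move=> /(_ s01) opt _; right.
  by have := quad _ s01; rewrite -/(K t.+1); lra.
rewrite /short_step; case: eqP => [vx ->|/eqP vx].
  by rewrite /K vx (subrr (x t.+1)) (is_norm0 N nN) expr0n/= => le_q; left; lra.
have Nvx : N (v t.+1 - x t.+1) != 0.
  by apply/eqP => N0; case: nN => _ _ /(_ _ N0)/eqP; rewrite subr_eq0 (negbTE vx).
rewrite -/(K t.+1) => gE le_q; have [K0|K0] := ltP 0 (K t.+1).
  right; have := short_step_minimizes _ _ _ _ K0 s1 gE; lra.
have {}K0 : K t.+1 = 0 by apply/eqP; rewrite eq_le K0 K_ge0.
(* Here the step is 0, so the gap does not increase; [K t.+1 = 0] with a nonzero norm forces
   [L = 0], and [L0] then gives its sign. *)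
move: le_q; rewrite gE K0 invr0 mulr0 min_r// => le_q.
move/eqP: K0; rewrite mulf_eq0 sqrf_eq0 (negbTE Nvx) orbF => /eqP /L0.
left; lra.
Qed.

Lemma gap_rate :
  (forall t, (1 <= t)%N ->
     gamma t = short_step N L (x t) (v t) (gap alg f gamma x v t.-1) \/
     is_argmin `[0, 1]%classic
       (gap_bound f (x t) (v t) (gap alg f gamma x v t.-1)) (gamma t)) ->
  forall t, gap alg f gamma x v t <= 4 * C / (t + 2)%:R.
Proof.
move=> step; have C0 : 0 <= C := le_trans (K_ge0 0) (K_le 0).
elim=> [|t IH].
  by have := gap0_le; rewrite add0n; lra.
rewrite addSnnS.
have s01 : 0 <= (2 : R) / (t + 3)%:R <= 1.
  by rewrite divr_ge0 ?ler0n// ler_pdivrMr ?ltr0n ?addnS// mul1r ler_nat.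
(* If [L = 0] then [C = 0], and the induction hypothesis itself says that the gap is nonpositive. *)
have L0 : L = 0 -> gap alg f gamma x v t <= 0.
  by move: IH; rewrite /C => + LE; rewrite LE mul0r mulr0 mul0r.
have [G0|] := gap_le_any_step t _ s01 (step t.+1 isT) L0.
  by apply: le_trans G0 _; rewrite divr_ge0 ?ler0n// mulr_ge0.
by move/le_trans; apply; exact: rate_recursion.
Qed.

End Rate.
End Run.

Theorem proposition4p1 (R : realType) (d : nat) (X : set 'rV[R]_d)
    (f : 'rV[R]_d -> R) (alg : algorithm) (gamma : nat -> R)
    (x v : nat -> 'rV[R]_d) :
  X !=set0 -> compact X -> convex_set X -> convex_function X f ->
  (exists U : set 'rV[R]_d,
      [/\ open U, X `<=` U & forall y, U y -> differentiable f y]) ->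
  is_run alg f gamma x v X ->
  let G := gap alg f gamma x v in
  (forall t : nat, (1 < t)%N ->
     G t <= gap_bound f (x t) (v t) (G t.-1) (gamma t) /\
     convex_function (`[0, 1]%classic : set R)
       (gap_bound f (x t) (v t) (G t.-1))) /\
  (forall (N : 'rV[R]_d -> R) (L D : R),
     is_norm N -> smooth_on X f N L -> is_diameter X N D ->
     (forall t : nat, (1 <= t)%N ->
        gamma t = short_step N L (x t) (v t) (G t.-1) \/
        is_argmin `[0, 1]%classic
          (gap_bound f (x t) (v t) (G t.-1)) (gamma t)) ->
     forall t : nat, G t <= 4 * L * D ^+ 2 / (t + 2)%:R).
Proof.
move=> _ _ cX cf [U [_ XU dU]] run G.
have df y : X y -> differentiable f y by move/XU/dU.
split=> [[//|t] _|N L D nN sf diamD step t].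
  split; first exact: (gap_le_gap_bound X).
  apply: (convex_gap_bound X) => //; first exact: (run_iterate_mem X _ _ _ _ _ cX run).
  exact: (run_oracle_mem X _ _ _ _ _ run).
rewrite -(mulrA 4 L).
exact: (gap_rate X f alg gamma x v cX run N L D cf df nN sf diamD step).
Qed.
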